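(* Let $\mathfrak{a}$ be a Lie antialgebra and $\mathcal{B}$ an $\mathfrak{a}$-module. For a parity preserving bilinear map $c:\mathfrak{a}\times\mathfrak{a}\to\mathcal{B}$ with $c(a,a')=(-1)^{\bar a\bar a'}c(a',a)$, consider on $\mathfrak{a}\oplus\mathcal{B}$ the product $$(a,b)\cdot(a',b')=\left(a\cdot a',\;a\cdot b'+(-1)^{\bar a'\bar b}\,a'\cdot b+c(a,a')\right).\qquad( * )$$ (i) The formula $( * )$ defines a Lie antialgebra structure on $\mathfrak{a}\oplus\mathcal{B}$ if and only if $c$ is a 2-cocycle. (ii) Two extensions $\widetilde{\mathfrak{a}}$ and $\widetilde{\mathfrak{a}}'$ of the same Lie antialgebra $\mathfrak{a}$ by the module $\mathcal{B}$, given by $( * )$ with cocycles $c_1$ and $c_2$ respectively, are isomorphic (by an isomorphism of the form $(a,b)\mapsto(a,b+L(a))$ with $L:\mathfrak{a}\to\mathcal{B}$ linear) if and only if $c_1$ and $c_2$ define the same cohomology class in $H^2(\mathfrak{a};\mathcal{B})$.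
   Context: Vector spaces are over a field $\mathbb{K}$ of characteristic $0$. A Lie antialgebra is a commutative $\mathbb{Z}_2$-graded algebra $(\mathfrak{a}=\mathfrak{a}_0\oplus\mathfrak{a}_1,\cdot)$ (i.e. $\mathfrak{a}_i\cdot\mathfrak{a}_j\subset\mathfrak{a}_{i+j}$, $a\cdot b=(-1)^{\bar a\bar b}b\cdot a$) satisfying, for all $x,x_i\in\mathfrak{a}_0$ and $y,y_i\in\mathfrak{a}_1$: $x_1\cdot(x_2\cdot x_3)=(x_1\cdot x_2)\cdot x_3$; $x_1\cdot(x_2\cdot y)=\frac12(x_1\cdot x_2)\cdot y$; $x\cdot(y_1\cdot y_2)=(x\cdot y_1)\cdot y_2+y_1\cdot(x\cdot y_2)$; $y_1\cdot(y_2\cdot y_3)+y_2\cdot(y_3\cdot y_1)+y_3\cdot(y_1\cdot y_2)=0$. An $\mathfrak{a}$-module is a $\mathbb{Z}_2$-graded space $\mathcal{B}=\mathcal{B}_0\oplus\mathcal{B}_1$ with a parity preserving bilinear action $(a,b)\mapsto a\cdot b$ of $\mathfrak{a}$ such that $\mathfrak{a}\oplus\mathcal{B}$ with product $(a,b)\cdot(a',b')=(a\cdot a',\,a\cdot b'+(-1)^{\bar a'\bar b}a'\cdot b)$ is a Lie antialgebra, denoted $\mathfrak{a}\ltimes\mathcal{B}$; thus $b\cdot a=(-1)^{\bar a\bar b}a\cdot b$. The extensions considered are exact sequences of Lie antialgebras $0\to\mathcal{B}\to\widetilde{\mathfrak{a}}\to\mathfrak{a}\to0$ with $\mathcal{B}$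 a trivial algebra, where $\widetilde{\mathfrak{a}}=\mathfrak{a}\oplus\mathcal{B}$ with product $( * )$. Cochains: for $p+q\ge1$, $C^{p,q}(\mathfrak{a};\mathcal{B})$ is the space of multilinear maps $\varphi:\mathfrak{a}_0^{\times p}\times\mathfrak{a}_1^{\times q}\to\mathcal{B}$, skew-symmetric in the $\mathfrak{a}_1$-variables, with values in $\mathcal{B}_0$ if $q$ is even and in $\mathcal{B}_1$ if $q$ is odd; $C^k(\mathfrak{a};\mathcal{B})=\bigoplus_{p+q=k}C^{p,q}(\mathfrak{a};\mathcal{B})$. On $\mathfrak{a}\oplus\mathcal{B}$ put $m(u,v)=\frac12u\cdot v$ if $u,v$ are both even and $m(u,v)=u\cdot v$ if $(u,v)$ is (even, odd) or (odd, odd), the product being that of $\mathfrak{a}\ltimes\mathcal{B}$. The differential $\delta=\delta_{1,0}+\delta_{0,1}+\delta_{-1,2}:C^k\to C^{k+1}$, $\delta_{i,j}:C^{p,q}\to C^{p+i,q+j}$, is given for $\varphi\in C^{p,q}$ by: $\bullet$ $q=0$: $(\delta_{1,0}\varphi)(x_0,\ldots,x_p)=-m(x_0,\varphi(x_1,\ldots,x_p))+\sum_{i=0}^{p-1}(-1)^i\varphi(x_0,\ldots,m(x_i,x_{i+1}),\ldots,x_p)+(-1)^pm(\varphi(x_0,\ldots,x_{p-1}),x_p)$; $\bullet$ $q>0$: $(\delta_{1,0}\varphi)(x_0,\ldots,x_p;y_0,\ldots,y_{q-1})=-m(x_0,\varphi(x_1,\ldots,x_p;y_0,\ldots,y_{q-1}))+\sum_{i=0}^{p-1}(-1)^i\varphi(x_0,\ldots,m(x_i,x_{i+1}),\ldots,x_p;y_0,\ldots,y_{q-1})+\frac1q\sum_{j=0}^{q-1}(-1)^{p+j}\varphi(x_0,\ldots,x_{p-1};m(x_p,y_j),y_0,\ldots,\widehat{y_j},\ldots,y_{q-1})$;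 $\bullet$ $(\delta_{0,1}\varphi)(x_0,\ldots,x_{p-1};y_0,\ldots,y_q)=\frac{\kappa}{q+1}\sum_{j=0}^q(-1)^{p+j}m(\varphi(x_0,\ldots,x_{p-1};y_0,\ldots,\widehat{y_j},\ldots,y_q),y_j)$, with $\kappa=2$ if $p=0$ and $q$ is odd, and $\kappa=1$ otherwise; $\bullet$ $(\delta_{-1,2}\varphi)(x_0,\ldots,x_{p-2};y_0,\ldots,y_{q+1})=\frac{2}{(q+1)(q+2)}\sum_{i<j}(-1)^{p+i+j}\varphi(x_0,\ldots,x_{p-2},m(y_i,y_j);y_0,\ldots,\widehat{y_i},\ldots,\widehat{y_j},\ldots,y_{q+1})$ if $p>0$, and $\delta_{-1,2}\varphi=0$ if $p=0$. $k$-cocycles are the elements of $\ker(\delta:C^k\to C^{k+1})$, $k$-coboundaries those of $\delta(C^{k-1})$, and $H^k(\mathfrak{a};\mathcal{B})$ is the quotient. The bilinear map $c$ is identified with the element $\hat c\in C^2(\mathfrak{a};\mathcal{B})$ given, in the same normalization as $m$, by $\hat c(x_1,x_2)=\frac12c(x_1,x_2)$, $\hat c(x,y)=c(x,y)$, $\hat c(y_1,y_2)=c(y_1,y_2)$; ''$c$ is a 2-cocycle'' and ''cohomology class of $c$'' refer to $\hat c$. *)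

(* Defs.v *)
From mathcomp Require Import all_boot all_order all_algebra.
From mathcomp Require Import boolp classical_sets.
Set Implicit Arguments.
Unset Strict Implicit.
Unset Printing Implicit Defensive.
Import GRing.Theory.
Local Open Scope ring_scope.

(* A Z_2-graded space is given by its even and odd components; parities are   *)
(* booleans (true = odd), so that addition of parities is (+) and their       *)
(* product is &&.                                                             *)
Record gspace (K : fieldType) := GSpace { ev : lmodType K; od : lmodType K }.

Section GradedSpaces.
Variable K : fieldType.
Implicit Types U V W : gspace K.

Definition tot V : lmodType K := (ev V * od V)%type.

Definition inEven V (x : ev V) : tot V := (x, 0).
Definition inOdd V (y : od V) : tot V := (0, y).

Definition part V (i : bool) (u : tot V) : tot V :=
  if i then inOdd u.2 else inEven u.1.

Definition homogeneous V (i : bool) (u : tot V) : Prop := part i u = u.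

Definition is_bilinear U V W (f : tot U -> tot V -> tot W) : Prop :=
  (forall v, linear (f^~ v)) /\ (forall u, linear (f u)).

Definition parity_preserving2 U V W (f : tot U -> tot V -> tot W) : Prop :=
  forall i j u v, homogeneous i u -> homogeneous j v ->
    homogeneous (i (+) j) (f u v).

Definition graded_commutative V W (f : tot V -> tot V -> tot W) : Prop :=
  forall i j u v, homogeneous i u -> homogeneous j v ->
    f u v = (-1) ^+ (i && j) *: f v u.

End GradedSpaces.

Arguments inEven {K V}.
Arguments inOdd {K V}.

Section LieAntialgebras.
Variable K : fieldType.

Record lie_antialgebra (V : gspace K) (mul : tot V -> tot V -> tot V) : Prop :=
  LieAntialgebra {
    la_bilinear : is_bilinear mul;
    la_parity : parity_preserving2 mul;
    la_commutative : graded_commutative mul;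
    la_assoc : forall x1 x2 x3 : ev V,
      mul (inEven x1) (mul (inEven x2) (inEven x3))
      = mul (mul (inEven x1) (inEven x2)) (inEven x3);
    la_half : forall (x1 x2 : ev V) (y : od V),
      mul (inEven x1) (mul (inEven x2) (inOdd y))
      = 2^-1 *: mul (mul (inEven x1) (inEven x2)) (inOdd y);
    la_leibniz : forall (x : ev V) (y1 y2 : od V),
      mul (inEven x) (mul (inOdd y1) (inOdd y2))
      = mul (mul (inEven x) (inOdd y1)) (inOdd y2)
        + mul (inOdd y1) (mul (inEven x) (inOdd y2));
    la_jacobi : forall y1 y2 y3 : od V,
      mul (inOdd y1) (mul (inOdd y2) (inOdd y3))
      + mul (inOdd y2) (mul (inOdd y3) (inOdd y1))
      + mul (inOdd y3) (mul (inOdd y1) (inOdd y2)) = 0 }.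

Record lie_antialgebra_iso (V W : gspace K)
    (mulV : tot V -> tot V -> tot V) (mulW : tot W -> tot W -> tot W)
    (f : tot V -> tot W) : Prop := LieAntialgebraIso {
  iso_linear : linear f;
  iso_parity : forall i u, homogeneous i u -> homogeneous i (f u);
  iso_mul : forall u v, f (mulV u v) = mulW (f u) (f v);
  iso_bijective : bijective f }.

End LieAntialgebras.

Section Extensions.
Variables (K : fieldType) (a B : gspace K).

Definition dsum : gspace K := GSpace (ev a * ev B)%type (od a * od B)%type.

Definition gpair (u : tot a) (b : tot B) : tot dsum := ((u.1, b.1), (u.2, b.2)).
Definition gfst (w : tot dsum) : tot a := (w.1.1, w.2.1).
Definition gsnd (w : tot dsum) : tot B := (w.1.2, w.2.2).

Variables (mul : tot a -> tot a -> tot a) (act : tot a -> tot B -> tot B).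

(* The right action b . u, equal to (-1)^(|u||b|) u . b on homogeneous        *)
(* elements, extended bilinearly.                                             *)
Definition ract (b : tot B) (u : tot a) : tot B :=
  \sum_(i : bool) \sum_(j : bool) (-1) ^+ (i && j) *: act (part i u) (part j b).

Definition ext_mul (c : tot a -> tot a -> tot B) (w w' : tot dsum) : tot dsum :=
  gpair (mul (gfst w) (gfst w'))
        (act (gfst w) (gsnd w') + ract (gsnd w) (gfst w') + c (gfst w) (gfst w')).

Definition semidirect_mul : tot dsum -> tot dsum -> tot dsum :=
  ext_mul (fun _ _ => 0).

Definition is_module : Prop :=
  [/\ is_bilinear act, parity_preserving2 act & lie_antialgebra semidirect_mul].

End Extensions.

Section Cohomology.
Variables (K : fieldType) (a B : gspace K).
Variables (mul : tot a -> tot a -> tot a) (act : tot a -> tot B -> tot B).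

(* A k-cochain, i.e. a family of maps a_0^p * a_1^q -> B for p + q = k, is    *)
(* encoded as one function of the word s of even arguments and the word t of  *)
(* odd arguments, vanishing unless size s + size t = k; its component in      *)
(* C^{p,q} is its restriction to size s = p and size t = q. With this         *)
(* definition C^0 = 0, since only p + q >= 1 is considered.                   *)
Definition cochain := seq (ev a) -> seq (od a) -> tot B.

Record is_cochain (k : nat) (phi : cochain) : Prop := IsCochain {
  cochain_supp : forall s t,
    ~~ ((0 < k) && (size s + size t == k))%N -> phi s t = 0;
  cochain_parity : forall s t, homogeneous (odd (size t)) (phi s t);
  cochain_linear_even : forall s1 s2 t,
    linear (fun x => phi (s1 ++ x :: s2) t);
  cochain_linear_odd : forall s t1 t2,
    linear (fun y => phi s (t1 ++ y :: t2));
  cochain_skew : forall s t1 t2 t3 y y',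
    phi s (t1 ++ y :: t2 ++ y' :: t3) = - phi s (t1 ++ y' :: t2 ++ y :: t3) }.

(* m is only applied to pairs whose parities are not (odd, even); on such     *)
(* pairs its value is irrelevant.                                             *)
Definition m (u v : tot (dsum a B)) : tot (dsum a B) :=
  \sum_(i : bool) \sum_(j : bool) (if ~~ i && ~~ j then 2^-1 else 1) *:
    semidirect_mul mul act (part i u) (part j v).

Definition inA (u : tot a) : tot (dsum a B) := gpair u 0.
Definition inB (b : tot B) : tot (dsum a B) := gpair 0 b.

Definition mAA (u v : tot a) : tot a := gfst (m (inA u) (inA v)).
Definition mAB (u : tot a) (b : tot B) : tot B := gsnd (m (inA u) (inB b)).
Definition mBA (b : tot B) (u : tot a) : tot B := gsnd (m (inB b) (inA u)).

Definition omit T (j : nat) (t : seq T) := take j t ++ drop j.+1 t.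

(* In the three parts of the differential, (p, q) is the bidegree of the      *)
(* component of phi that contributes to the value at (s; t).                  *)

Definition delta10 (phi : cochain) : cochain := fun s t =>
  if s is x0 :: s' then
    let p := size s' in
    let q := size t in
    - mAB (inEven x0) (phi s' t)
    + \sum_(i < p) (-1) ^+ i *:
        phi (take i s ++ (mAA (inEven s`_i) (inEven s`_i.+1)).1 :: drop i.+2 s) t
    + (if q == 0%N then
         (-1) ^+ p *: mBA (phi (take p s) [::]) (inEven s`_p)
       else
         q%:R^-1 *: \sum_(j < q) (-1) ^+ (p + j) *:
           phi (take p s) ((mAA (inEven s`_p) (inOdd t`_j)).2 :: omit j t))
  else 0.

Definition kappa (p q : nat) : K :=
  if (p == 0%N) && odd q then 2 else 1.

Definition delta01 (phi : cochain) : cochain := fun s t =>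
  if t is _ :: t' then
    let p := size s in
    let q := size t' in
    (kappa p q / q.+1%:R) *: \sum_(j < q.+1) (-1) ^+ (p + j) *:
      mBA (phi s (omit j t)) (inOdd t`_j)
  else 0.

Definition deltam12 (phi : cochain) : cochain := fun s t =>
  if t is _ :: _ :: t' then
    let p := (size s).+1 in
    let q := size t' in
    (2 / (q.+1 * q.+2)%:R) *:
      \sum_(j < q.+2) \sum_(i < j) (-1) ^+ (p + i + j) *:
        phi (rcons s (mAA (inOdd t`_i) (inOdd t`_j)).1) (omit i (omit j t))
  else 0.

Definition delta (phi : cochain) : cochain := fun s t =>
  delta10 phi s t + delta01 phi s t + deltam12 phi s t.

Definition cocycle (k : nat) (phi : cochain) : Prop :=
  is_cochain k phi /\ forall s t, delta phi s t = 0.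

Definition coboundary (k : nat) (phi : cochain) : Prop :=
  exists2 psi, is_cochain k.-1 psi & forall s t, phi s t = delta psi s t.

(* H^k is the set of the cosets of the k-coboundaries in the k-cocycles.      *)
Definition cohomology_class (k : nat) (phi : cochain) : set cochain :=
  [set psi | cocycle k psi /\ coboundary k (fun s t => psi s t - phi s t)].

Definition hat (c : tot a -> tot a -> tot B) : cochain := fun s t =>
  match s, t with
  | [:: x1; x2], [::] => 2^-1 *: c (inEven x1) (inEven x2)
  | [:: x], [:: y] => c (inEven x) (inOdd y)
  | [::], [:: y1; y2] => c (inOdd y1) (inOdd y2)
  | _, _ => 0
  end.

End Cohomology.

(* Main.v *)
(* Every Lie antialgebra axiom for the twisted product is the same axiom for  *)
(* the semidirect product plus a B-valued term linear in c. So the twisted    *)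
(* product is a Lie antialgebra iff four equations in c hold, and graded      *)
(* commutativity turns these into the vanishing of the components of          *)
(* delta (hat c) in bidegrees (3,0), (2,1), (1,2) and (0,3), up to the        *)
(* factors 1/4, 1, 1/2 and 1/3. Likewise a 1-cochain is a parity preserving   *)
(* linear map L, its differential is the hat of                               *)
(* (u, v) |-> L(u.v) - u.L(v) - L(u).v, and (u, b) |-> (u, b + L u) is        *)
(* multiplicative from the product of c1 to that of c2 iff c2 - c1 is this    *)
(* bilinear map.                                                              *)
From HB Require Import structures.
Require Import Defs.
From mathcomp Require Import all_boot all_order all_algebra.
From mathcomp Require Import zify.
From mathcomp Require Import boolp classical_sets.
Import GRing.Theory.
Local Open Scope ring_scope.

(** * Graded spaces *)

(** In a double product of the twisted algebra, [c] enters the [B]-part exactly twice: in the inner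
    product, where its value is acted on by the remaining factor, and in the outer product, where
    one argument is a product in [a]. As [c] only sees [a]-parts and takes values in [B], no term
    quadratic in [c] arises. Hence [ext_mul_nestr] and [ext_mul_nestl] split each axiom into the
    semidirect one and a member of the linear system [extension_equations]. The four lemmas from
    [delta_hat30] to [delta_hat03] compute the differential on all words of length three; their
    coefficients are invertible in characteristic 0, so [ext_lie_antialgebraE] and [cocycle_hatE]
    together give (i).

    For (ii), [defect L] measures how far [L] is from a derivation. By [delta_hat1] it represents
    the coboundary of [L], and by [ext_mul_isoE] it is the difference of two cocycles whose
    extensions are identified through [L]. [cohomology_class_eqE] turns equality of cosets into the
    existence of such an [L], since [hat] is injective on graded commutative bilinear maps
    ([hat_inj]). *)

Section LinearMaps.
Context {K : fieldType} {U V : lmodType K} {f : U -> V} (f_lin : linear f).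

(** The definitions use the bare predicate [linear]; bundling [f] gives access to the library lemmas
    on linear maps. *)
Let F : {linear U -> V} := HB.pack f (GRing.isLinear.Build K U V *:%R f f_lin).

Lemma linear_0 : f 0 = 0. Proof. exact: (linear0 F). Qed.

Lemma linear_N u : f (- u) = - f u. Proof. exact: (linearN F). Qed.

Lemma linear_D u v : f (u + v) = f u + f v. Proof. exact: (linearD F). Qed.

Lemma linear_B u v : f (u - v) = f u - f v. Proof. exact: (linearB F). Qed.

Lemma linear_Z k u : f (k *: u) = k *: f u. Proof. exact: (linearZZ F). Qed.

End LinearMaps.

Section Homogeneous.
Context {K : fieldType} {V : gspace K}.
Implicit Types (u v : tot V) (i j : bool).

Lemma homogeneousP i u :
  homogeneous i u <-> (if i then u.1 = 0 else u.2 = 0).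
Proof.
by case: u => x y; case: i; split=> [[<-]|/= ->].
Qed.

(** Collapses the double sums over parities in [ract] and [m] to one term. *)
Lemma part_homogeneous i j u :
  homogeneous i u -> part j u = if i == j then u else 0.
Proof.
move=> /homogeneousP; case: u => x y.
by case: i; case: j => //= ->.
Qed.

Lemma part_linear i : linear (@part K V i).
Proof.
by case: i => k u v; apply: injective_projections => /=; rewrite ?scaler0 ?addr0.
Qed.

Lemma partD u : u = part false u + part true u.
Proof. by apply: injective_projections; rewrite /= ?addr0 ?add0r. Qed.

Lemma homogeneousD i u v :
  homogeneous i u -> homogeneous i v -> homogeneous i (u + v).
Proof. by move=> hu hv; rewrite /homogeneous (linear_D (part_linear i)) hu hv. Qed.

Lemma homogeneousZ i k u : homogeneous i u -> homogeneous i (k *: u).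
Proof. by move=> hu; rewrite /homogeneous (linear_Z (part_linear i)) hu. Qed.

Lemma homogeneous0 i : homogeneous i (0 : tot V).
Proof. exact: linear_0 (part_linear i). Qed.

Lemma inEven_homogeneous (x : ev V) : homogeneous false (inEven x).
Proof. by []. Qed.

Lemma inOdd_homogeneous (y : od V) : homogeneous true (inOdd y).
Proof. by []. Qed.

Lemma inEvenK u : homogeneous false u -> inEven u.1 = u.
Proof. by []. Qed.

Lemma inOddK u : homogeneous true u -> inOdd u.2 = u.
Proof. by []. Qed.

Lemma inEven_linear : linear (@inEven K V).
Proof. by move=> k x y; apply: injective_projections; rewrite //= scaler0 addr0. Qed.

Lemma inOdd_linear : linear (@inOdd K V).
Proof. by move=> k x y; apply: injective_projections; rewrite //= scaler0 addr0. Qed.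

End Homogeneous.

Arguments homogeneousP {K V i u}.
#[local] Hint Resolve inEven_homogeneous inOdd_homogeneous homogeneous0 : core.

(** * The twisted product *)

Section Extensions.
Context {K : fieldType} {a B : gspace K}.
Variables (mul : tot a -> tot a -> tot a) (act : tot a -> tot B -> tot B).
Hypotheses (Ha : lie_antialgebra mul) (HB : is_module mul act).
Implicit Types (c : tot a -> tot a -> tot B) (u v : tot a) (b : tot B).
Implicit Types (w : tot (dsum a B)).

Let semi := semidirect_mul mul act.
Let mulL v : linear (mul^~ v) := (la_bilinear Ha).1 v.
Let mulR u : linear (mul u) := (la_bilinear Ha).2 u.
Let act_bil : is_bilinear act := let: And3 h _ _ := HB in h.
Let actL b : linear (act^~ b) := act_bil.1 b.
Let actR u : linear (act u) := act_bil.2 u.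
Let act_par : parity_preserving2 act := let: And3 _ h _ := HB in h.
Let semi_la : lie_antialgebra semi := let: And3 _ _ h := HB in h.

(** Of the four terms in the parity sum only the one at the actual parities survives, which recovers
    the sign rule for the right action. *)
Lemma ract_homogeneous i j b u : homogeneous i b -> homogeneous j u ->
  ract act b u = (-1) ^+ (i && j) *: act u b.
Proof.
move=> hb hu; rewrite /ract !big_bool.
rewrite !(part_homogeneous _ _ _ hb) !(part_homogeneous _ _ _ hu).
by case: i {hb}; case: j {hu} => /=;
  rewrite ?(linear_0 (actL _)) ?(linear_0 (actR _)) ?scaler0 ?addr0 ?add0r.
Qed.

Lemma ract_bilinear : is_bilinear (ract act).
Proof.
split=> [u|b] k v v'; rewrite /ract scaler_sumr -big_split; apply: eq_bigr => i _;
  rewrite scaler_sumr -big_split; apply: eq_bigr => j _ /=;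
  by rewrite (part_linear _ _ _ _) ?actL ?actR scalerDr !scalerA mulrC.
Qed.

Let ractL u : linear ((ract act)^~ u) := ract_bilinear.1 u.
Let ractR b : linear (ract act b) := ract_bilinear.2 b.

Lemma gfst_gpair u b : gfst (gpair u b) = u. Proof. by case: u. Qed.

Lemma gsnd_gpair u b : gsnd (gpair u b) = b. Proof. by case: b. Qed.

Lemma gpair_linear k u u' b b' :
  gpair (k *: u + u') (k *: b + b') = k *: gpair u b + gpair u' b'.
Proof. by []. Qed.

Lemma gfst_linear : linear (@gfst K a B).
Proof. by []. Qed.

Lemma gsnd_linear : linear (@gsnd K a B).
Proof. by []. Qed.

Lemma inB_linear : linear (@inB K a B).
Proof. by move=> k b b'; rewrite /inB -gpair_linear scaler0 addr0. Qed.

Lemma inB_inj : injective (@inB K a B).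
Proof. by move=> b b' /(congr1 (@gsnd K a B)); case: b b' => [? ?] []. Qed.

Lemma dsum_eq w w' : gfst w = gfst w' -> gsnd w = gsnd w' -> w = w'.
Proof. by case: w w' => [[? ?] [? ?]] [[? ?] [? ?]] [-> ->] [-> ->]. Qed.

Lemma gfst_homogeneous i w : homogeneous i w -> homogeneous i (gfst w).
Proof.
by move=> /homogeneousP h; apply/homogeneousP; case: i h; rewrite /= => ->.
Qed.

Lemma gsnd_homogeneous i w : homogeneous i w -> homogeneous i (gsnd w).
Proof.
by move=> /homogeneousP h; apply/homogeneousP; case: i h; rewrite /= => ->.
Qed.

Lemma gpair_homogeneous i u b :
  homogeneous i u -> homogeneous i b -> homogeneous i (gpair u b).
Proof.
move=> /homogeneousP hu /homogeneousP hb; apply/homogeneousP.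
by case: i hu hb; rewrite /= => -> ->.
Qed.

(* The parts of [w . (w' . w'')] and of [(w . w') . w''] contributed by [c]. *)
Definition nestr c u v v' := act u (c v v') + c u (mul v v').
Definition nestl c u v v' := ract act (c u v) v' + c (mul u v) v'.

Lemma gfst_ext_mul c w w' :
  gfst (ext_mul mul act c w w') = mul (gfst w) (gfst w').
Proof. exact: gfst_gpair. Qed.

Lemma gsnd_ext_mul c w w' : gsnd (ext_mul mul act c w w') =
  act (gfst w) (gsnd w') + ract act (gsnd w) (gfst w') + c (gfst w) (gfst w').
Proof. exact: gsnd_gpair. Qed.

(** The action is additive, so the value of [c] in the inner product splits off; everything else is
    the double product with [c] = 0. *)
Lemma ext_mul_nestr c w w' w'' :
  ext_mul mul act c w (ext_mul mul act c w' w'') =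
  semi w (semi w' w'') + inB a (nestr c (gfst w) (gfst w') (gfst w'')).
Proof.
apply: dsum_eq.
  rewrite (linear_D gfst_linear) gfst_gpair addr0.
  by rewrite /semi /semidirect_mul !gfst_ext_mul.
rewrite (linear_D gsnd_linear) gsnd_gpair /semi /semidirect_mul.
rewrite !gsnd_ext_mul !gfst_ext_mul !addr0 (linear_D (actR _)) /nestr.
by rewrite -!addrA; congr (_ + _); rewrite addrCA.
Qed.

Lemma ext_mul_nestl c w w' w'' :
  ext_mul mul act c (ext_mul mul act c w w') w'' =
  semi (semi w w') w'' + inB a (nestl c (gfst w) (gfst w') (gfst w'')).
Proof.
apply: dsum_eq.
  rewrite (linear_D gfst_linear) gfst_gpair addr0.
  by rewrite /semi /semidirect_mul !gfst_ext_mul.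
rewrite (linear_D gsnd_linear) gsnd_gpair /semi /semidirect_mul.
by rewrite !gsnd_ext_mul !gfst_ext_mul !addr0 (linear_D (ractL _)) /nestl -!addrA.
Qed.

(** What remains of the four axioms of the twisted product once the same axioms of the semidirect
    product are cancelled. *)
Record extension_equations c : Prop := ExtensionEquations {
  ee_assoc : forall x1 x2 x3 : ev a,
    nestr c (inEven x1) (inEven x2) (inEven x3)
    = nestl c (inEven x1) (inEven x2) (inEven x3);
  ee_half : forall (x1 x2 : ev a) (y : od a),
    nestr c (inEven x1) (inEven x2) (inOdd y)
    = 2^-1 *: nestl c (inEven x1) (inEven x2) (inOdd y);
  ee_leibniz : forall (x : ev a) (y1 y2 : od a),
    nestr c (inEven x) (inOdd y1) (inOdd y2)
    = nestl c (inEven x) (inOdd y1) (inOdd y2)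
      + nestr c (inOdd y1) (inEven x) (inOdd y2);
  ee_jacobi : forall y1 y2 y3 : od a,
    nestr c (inOdd y1) (inOdd y2) (inOdd y3)
    + nestr c (inOdd y2) (inOdd y3) (inOdd y1)
    + nestr c (inOdd y3) (inOdd y1) (inOdd y2) = 0 }.

(** * The differential *)

Lemma m_homogeneous i j w w' : homogeneous i w -> homogeneous j w' ->
  m mul act w w' = (if ~~ i && ~~ j then 2^-1 else 1) *: semi w w'.
Proof.
move=> hw hw'; rewrite /m !big_bool.
rewrite !(part_homogeneous _ _ _ hw) !(part_homogeneous _ _ _ hw').
have [L0 R0] : (forall w, semi 0 w = 0) /\ (forall w, semi w 0 = 0).
  by split=> w1; [exact: linear_0 ((la_bilinear semi_la).1 _)
                 |exact: linear_0 ((la_bilinear semi_la).2 _)].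
rewrite /semi in L0 R0 *.
by case: i {hw}; case: j {hw'} => /=; rewrite ?L0 ?R0 ?scaler0 ?addr0 ?add0r.
Qed.

Lemma inA_homogeneous i u : homogeneous i u -> homogeneous i (inA B u).
Proof. by move=> hu; apply: gpair_homogeneous. Qed.

Lemma inB_homogeneous i b : homogeneous i b -> homogeneous i (inB a b).
Proof. by move=> hb; apply: gpair_homogeneous. Qed.

Lemma mAA_homogeneous {i j u v} : homogeneous i u -> homogeneous j v ->
  mAA mul act u v = (if ~~ i && ~~ j then 2^-1 else 1) *: mul u v.
Proof.
move=> /inA_homogeneous hu /inA_homogeneous hv.
rewrite /mAA (m_homogeneous _ _ _ _ hu hv) (linear_Z gfst_linear).
by rewrite gfst_ext_mul !gfst_gpair.
Qed.

Lemma mAB_homogeneous {i j u b} : homogeneous i u -> homogeneous j b ->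
  mAB mul act u b = (if ~~ i && ~~ j then 2^-1 else 1) *: act u b.
Proof.
move=> /inA_homogeneous hu /inB_homogeneous hb.
rewrite /mAB (m_homogeneous _ _ _ _ hu hb) (linear_Z gsnd_linear).
by rewrite gsnd_ext_mul !gfst_gpair !gsnd_gpair (linear_0 (ractR _)) !addr0.
Qed.

Lemma mBA_homogeneous {i j b u} : homogeneous i b -> homogeneous j u ->
  mBA mul act b u = (if ~~ i && ~~ j then 2^-1 else 1) *: ract act b u.
Proof.
move=> /inB_homogeneous hb /inA_homogeneous hu.
rewrite /mBA (m_homogeneous _ _ _ _ hb hu) (linear_Z gsnd_linear).
by rewrite gsnd_ext_mul !gfst_gpair !gsnd_gpair (linear_0 (actR _)) add0r addr0.
Qed.

(** Zero has both parities, so it may be taken even here and in the next two lemmas; they serve to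
    kill terms in [delta_supp]. *)
Lemma mAB0 x : mAB mul act (inEven x) 0 = 0.
Proof.
by rewrite (mAB_homogeneous (inEven_homogeneous _) (homogeneous0 false))
  (linear_0 (actR _)) scaler0.
Qed.

Lemma m0A_even x : mBA mul act 0 (inEven x) = 0.
Proof.
by rewrite (mBA_homogeneous (homogeneous0 false) (inEven_homogeneous _))
  (linear_0 (ractL _)) scaler0.
Qed.

Lemma m0A_odd y : mBA mul act 0 (inOdd y) = 0.
Proof.
by rewrite (mBA_homogeneous (homogeneous0 false) (inOdd_homogeneous _))
  (linear_0 (ractL _)) scaler0.
Qed.

Lemma size_omit T j (t : seq T) : (j < size t)%N -> size (omit j t) = (size t).-1.
Proof. by move=> lt_jt; rewrite /omit size_cat size_take_min size_drop; lia. Qed.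

(** Every term evaluates [phi] at words whose total length is one less: an argument is dropped, or
    two arguments are multiplied into one. *)
Lemma delta_supp k phi s t : is_cochain k phi -> (size s + size t != k.+1)%N ->
  delta mul act phi s t = 0.
Proof.
move=> phi_k st_k.
have phi0 s' t' : (size s' + size t' != k)%N -> phi s' t' = 0.
  by move=> st'_k; apply: (cochain_supp phi_k); rewrite negb_and st'_k orbT.
have -> : delta mul act phi s t = 0 + 0 + 0; last by rewrite !addr0.
congr (_ + _ + _).
- case: s st_k => [//|x0 s] /= st_k.
  rewrite phi0 ?mAB0 ?oppr0 ?add0r; last by lia.
  rewrite big1 ?add0r => [|i _]; last first.
    rewrite phi0 ?scaler0 // size_cat size_take_min /= size_drop /=.
    by have := ltn_ord i; lia.
  case: eqP => [t0|_].
    rewrite phi0 ?m0A_even ?scaler0 // size_take_min /=.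
    by rewrite t0 in st_k; lia.
  rewrite big1 ?scaler0 // => j _; rewrite phi0 ?scaler0 // size_take_min /=.
  by rewrite size_omit //; have := ltn_ord j; lia.
- case: t st_k => [//|y t] /= st_k.
  rewrite big1 ?scaler0 // => j _; rewrite phi0 ?m0A_odd ?scaler0 //.
  by rewrite size_omit //=; have := ltn_ord j; lia.
- case: t st_k => [//|y [//|y' t]] /= st_k.
  rewrite big1 ?scaler0 // => j _; rewrite big1 // => i _.
  have [lt_j lt_i] := (ltn_ord j, ltn_ord i).
  by rewrite phi0 ?scaler0 // size_rcons !size_omit //= ?size_omit //=; lia.
Qed.

Lemma mAA_even_even x x' : (mAA mul act (inEven x) (inEven x')).1 =
  2^-1 *: (mul (inEven x) (inEven x')).1.
Proof.
by rewrite (mAA_homogeneous (inEven_homogeneous _) (inEven_homogeneous _)).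
Qed.

Lemma mAA_even_odd x y : (mAA mul act (inEven x) (inOdd y)).2 =
  (mul (inEven x) (inOdd y)).2.
Proof.
by rewrite (mAA_homogeneous (inEven_homogeneous _) (inOdd_homogeneous _)) scale1r.
Qed.

Lemma mAA_odd_odd y y' : (mAA mul act (inOdd y) (inOdd y')).1 =
  (mul (inOdd y) (inOdd y')).1.
Proof.
by rewrite (mAA_homogeneous (inOdd_homogeneous _) (inOdd_homogeneous _)) scale1r.
Qed.

(** The differential feeds components of products to a cochain, and [hat] injects them back into
    [a]; parity preservation makes the round trip harmless. *)
Let mul_ee x x' : inEven (mul (inEven x) (inEven x')).1 = mul (inEven x) (inEven x').
Proof. exact: inEvenK (la_parity Ha (inEven_homogeneous _) (inEven_homogeneous _)). Qed.
Let mul_eo x y : inOdd (mul (inEven x) (inOdd y)).2 = mul (inEven x) (inOdd y).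
Proof. exact: inOddK (la_parity Ha (inEven_homogeneous _) (inOdd_homogeneous _)). Qed.
Let mul_oo y y' : inEven (mul (inOdd y) (inOdd y')).1 = mul (inOdd y) (inOdd y').
Proof. exact: inEvenK (la_parity Ha (inOdd_homogeneous _) (inOdd_homogeneous _)). Qed.

Hypothesis charK : [pchar K] =i pred0.
Let two_neq0 : 2 != 0 :> K.
Proof. by rewrite (pcharf0P K).1. Qed.
Let two_inv_neq0 : 2^-1 != 0 :> K.
Proof. by rewrite invr_eq0. Qed.

(* Keeps [/=] from unfolding the projections of [mAA]. *)
#[local] Opaque mAA mAB mBA.

(** * The twisted axioms and the cocycle condition for a fixed [c] *)

Section Cocycle.
Variable c : tot a -> tot a -> tot B.
Hypotheses (c_bil : is_bilinear c) (c_par : parity_preserving2 c)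
  (c_comm : graded_commutative c).
Let cL v : linear (c^~ v) := c_bil.1 v.
Let cR u : linear (c u) := c_bil.2 u.

Lemma ext_mul_bilinear : is_bilinear (ext_mul mul act c).
Proof.
split=> [w'|w] k v v'; rewrite /ext_mul -gpair_linear gfst_linear gsnd_linear;
  rewrite ?(mulL, mulR) ?(actL, actR) ?(ractL, ractR) ?(cL, cR) !scalerDr;
  by rewrite [X in gpair _ (X + _)]addrACA [X in gpair _ X]addrACA.
Qed.

Lemma ext_mul_parity : parity_preserving2 (ext_mul mul act c).
Proof.
move=> i j w w' hw hw'.
have [hu hu'] := (gfst_homogeneous _ _ hw, gfst_homogeneous _ _ hw').
have [hb hb'] := (gsnd_homogeneous _ _ hw, gsnd_homogeneous _ _ hw').
apply: gpair_homogeneous; first exact: la_parity.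
rewrite (ract_homogeneous _ _ _ _ hb hu').
apply: homogeneousD; last exact: c_par.
apply: homogeneousD; first exact: act_par.
by apply: homogeneousZ; rewrite addbC; apply: act_par.
Qed.

(** The sign in the right action is the one needed for the two action terms to change places when
    the factors are swapped. *)
Lemma ext_mul_commutative : graded_commutative (ext_mul mul act c).
Proof.
move=> i j w w' hw hw'.
have [hu hu'] := (gfst_homogeneous _ _ hw, gfst_homogeneous _ _ hw').
have [hb hb'] := (gsnd_homogeneous _ _ hw, gsnd_homogeneous _ _ hw').
apply: dsum_eq; rewrite ?(linear_Z gfst_linear) ?(linear_Z gsnd_linear).
  by rewrite !gfst_ext_mul; apply: (la_commutative Ha).
rewrite !gsnd_ext_mul !scalerDr -(c_comm _ _ _ _ hu hu'); congr (_ + _).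
rewrite (ract_homogeneous _ _ _ _ hb hu') (ract_homogeneous _ _ _ _ hb' hu).
rewrite scalerA andbC -expr2 sqrr_sign scale1r.
by rewrite addrC.
Qed.

Lemma ext_lie_antialgebraE :
  lie_antialgebra (ext_mul mul act c) <-> extension_equations c.
Proof.
split=> [h|h].
  split.
  (* Arguments with zero [B]-part suffice: the contribution of [c] depends only on the [a]-parts. *)
  - move=> x1 x2 x3; have := la_assoc h (x1, 0) (x2, 0) (x3, 0).
    by rewrite ext_mul_nestr ext_mul_nestl (la_assoc semi_la) => /addrI/inB_inj.
  - move=> x1 x2 y; have := la_half h (x1, 0) (x2, 0) (y, 0).
    rewrite ext_mul_nestr ext_mul_nestl (la_half semi_la) scalerDr => /addrI.
    by rewrite -(linear_Z inB_linear) => /inB_inj.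
  - move=> x y1 y2; have := la_leibniz h (x, 0) (y1, 0) (y2, 0).
    rewrite !ext_mul_nestr ext_mul_nestl (la_leibniz semi_la) addrACA => /addrI.
    by rewrite -(linear_D inB_linear) => /inB_inj.
  - move=> y1 y2 y3; have := la_jacobi h (y1, 0) (y2, 0) (y3, 0).
    rewrite !ext_mul_nestr (addrACA (semi _ _)) (addrACA (semi _ _ + _))
      (la_jacobi semi_la) add0r.
    rewrite -!(linear_D inB_linear) -(linear_0 inB_linear) => /inB_inj; exact.
have [h1 h2 h3 h4] := h.
split; [exact: ext_mul_bilinear|exact: ext_mul_parity|exact: ext_mul_commutative|..].
- by move=> x1 x2 x3; rewrite ext_mul_nestr ext_mul_nestl (la_assoc semi_la) h1.
- move=> x1 x2 y; rewrite ext_mul_nestr ext_mul_nestl (la_half semi_la) h2.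
  by rewrite (linear_Z inB_linear) scalerDr.
- move=> x y1 y2; rewrite !ext_mul_nestr ext_mul_nestl (la_leibniz semi_la) h3.
  by rewrite (linear_D inB_linear) addrACA.
- move=> y1 y2 y3; rewrite !ext_mul_nestr (addrACA (semi _ _)) (addrACA (semi _ _ + _))
      (la_jacobi semi_la) add0r.
  by rewrite -!(linear_D inB_linear) h4 (linear_0 inB_linear).
Qed.

(** The right action and the commutativity of [c] produce the same sign, since [c v v'] and
    [mul v v'] have the same parity. This converts the right actions on odd arguments in the
    differential into the right-nested terms of the axioms. *)
Lemma nestr_nestl {i j k u v v'} :
  homogeneous i u -> homogeneous j v -> homogeneous k v' ->
  nestr c u v v' = (-1) ^+ (i && (j (+) k)) *: nestl c v v' u.
Proof.
move=> hu hv hv'; rewrite /nestl (ract_homogeneous _ _ _ _ (c_par _ _ _ _ hv hv') hu).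
rewrite scalerDr scalerA andbC -expr2 sqrr_sign scale1r -andbC.
by rewrite -(c_comm _ _ _ _ hu (la_parity Ha hv hv')).
Qed.

Let c_ee x x' : homogeneous false (c (inEven x) (inEven x')).
Proof. exact: c_par (inEven_homogeneous _) (inEven_homogeneous _). Qed.
Let c_eo x y : homogeneous true (c (inEven x) (inOdd y)).
Proof. exact: c_par (inEven_homogeneous _) (inOdd_homogeneous _). Qed.
Let c_oo y y' : homogeneous false (c (inOdd y) (inOdd y')).
Proof. exact: c_par (inOdd_homogeneous _) (inOdd_homogeneous _). Qed.

(** Each term carries one factor 1/2 from [hat] and one from [m]. *)
Lemma delta_hat30 x0 x1 x2 : delta mul act (hat c) [:: x0; x1; x2] [::] =
  (2^-1 * 2^-1) *: (nestl c (inEven x0) (inEven x1) (inEven x2)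
                    - nestr c (inEven x0) (inEven x1) (inEven x2)).
Proof.
rewrite /delta /= !addr0 !big_ord_recl big_ord0 /= !mAA_even_even.
rewrite (mAB_homogeneous (inEven_homogeneous _) (homogeneousZ _ _ _ (c_ee _ _))) /=.
rewrite (mBA_homogeneous (homogeneousZ _ _ _ (c_ee _ _)) (inEven_homogeneous _)) /=.
rewrite !(linear_Z inEven_linear) !mul_ee.
rewrite (linear_Z (actR _)) (linear_Z (ractL _)) (linear_Z (cL _)) (linear_Z (cR _)).
rewrite !scalerA expr0 expr1 sqrrN expr1n.
rewrite !(mulN1r, mulNr, mul1r, scaleNr) addr0 /nestl /nestr.
rewrite scalerBr !scalerDr opprD addrC -[RHS]addrA; congr (_ + _).
exact: addrCA.
Qed.

(** The left-nested terms contain a pair of even arguments, hence the factor 1/2 of the second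
    axiom; the right-nested ones contain none. *)
Lemma delta_hat21 x0 x1 y : delta mul act (hat c) [:: x0; x1] [:: y] =
  2^-1 *: nestl c (inEven x0) (inEven x1) (inOdd y)
  - nestr c (inEven x0) (inEven x1) (inOdd y).
Proof.
rewrite /delta /= !addr0 !big_ord_recl !big_ord0 /= mAA_even_even !mAA_even_odd.
rewrite (mAB_homogeneous (inEven_homogeneous _) (c_eo _ _)) /=.
rewrite (mBA_homogeneous (homogeneousZ _ _ _ (c_ee _ _)) (inOdd_homogeneous _)) /=.
rewrite !(linear_Z inEven_linear) !mul_ee !mul_eo.
rewrite (linear_Z (ractL _)) (linear_Z (cL _)).
rewrite !scalerA expr0 expr1.
rewrite [kappa K _ _]/= divr1 invr1.
rewrite !(exprD, expr0, expr1, sqrrN, expr1n, mulr1, mul1r, mulN1r,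
    opprK, scaleNr, scale1r, add0r, addr0).
rewrite /nestl /nestr scalerDr opprD addrC -[RHS]addrA; congr (_ + _).
by rewrite [RHS]addrA; congr (_ + _); apply: addrC.
Qed.

Lemma delta_hat12 x y0 y1 : delta mul act (hat c) [:: x] [:: y0; y1] =
  2^-1 *: (nestl c (inEven x) (inOdd y0) (inOdd y1)
           + nestr c (inOdd y0) (inEven x) (inOdd y1)
           - nestr c (inEven x) (inOdd y0) (inOdd y1)).
Proof.
rewrite /delta /= !big_ord_recl !big_ord0 /= !mAA_even_odd !mAA_odd_odd.
rewrite (mAB_homogeneous (inEven_homogeneous _) (c_oo _ _)) /=.
rewrite !(mBA_homogeneous (c_eo _ _) (inOdd_homogeneous _)) /=.
rewrite !mul_oo !mul_eo.
have -> : bump 0 0 = 1%N by [].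
rewrite [kappa K _ _]/= mul1n divff // mul1r.
rewrite !(exprD, expr0, expr1, sqrrN, expr1n, mulr1, mul1r, mulN1r,
    opprK, scaleNr, scale1r, add0r, addr0).
(* Moving [y0] past an odd element yields -1, which matches the alternating sign over the odd
   arguments. *)
rewrite (nestr_nestl (inOdd_homogeneous y0) (inEven_homogeneous x)
  (inOdd_homogeneous y1)) /= expr1 scaleN1r.
rewrite -!scalerN -!scalerDr; congr (_ *: _); rewrite /nestl /nestr !opprD.
rewrite [RHS]addrA; congr (_ + _); rewrite -addrA addrC; congr (_ + _).
by rewrite addrC [- _ + ract _ _ _]addrC addrACA.
Qed.

Lemma delta_hat03 y0 y1 y2 : delta mul act (hat c) [::] [:: y0; y1; y2] =
  3^-1 *: (nestr c (inOdd y0) (inOdd y1) (inOdd y2)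
           + nestr c (inOdd y1) (inOdd y2) (inOdd y0)
           + nestr c (inOdd y2) (inOdd y0) (inOdd y1)).
Proof.
rewrite /delta /= !big_ord_recl !big_ord0 /= !mAA_odd_odd.
rewrite !(mBA_homogeneous (c_oo _ _) (inOdd_homogeneous _)) /=.
rewrite !mul_oo.
have -> : bump 0 0 = 1%N by [].
have -> : bump 0 1 = 2%N by [].
(* The coefficient 2/(2*3) of [deltam12] equals the 1/3 of [delta01]. *)
rewrite [kappa K _ _]/= natrM invfM mulrA divff // mul1r.
rewrite !(exprD, expr0, expr1, sqrrN, expr1n, mulr1, mul1r, mulN1r,
    opprK, scaleNr, scale1r, add0r, addr0).
rewrite -scalerDr; congr (_ *: _).
rewrite (nestr_nestl (inOdd_homogeneous y0) (inOdd_homogeneous y1)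
  (inOdd_homogeneous y2)) (nestr_nestl (inOdd_homogeneous y1)
  (inOdd_homogeneous y2) (inOdd_homogeneous y0))
  (nestr_nestl (inOdd_homogeneous y2) (inOdd_homogeneous y0)
  (inOdd_homogeneous y1)) /= !scale1r /nestl.
(* The differential lists the middle pair as [y0], [y2], the cyclic sum as [y2], [y0]; skew-symmetry
   on odd elements absorbs the minus sign. *)
rewrite (c_comm _ _ _ _ (inOdd_homogeneous y2) (inOdd_homogeneous y0)) /= expr1 scaleN1r.
rewrite (la_commutative Ha (inOdd_homogeneous y2) (inOdd_homogeneous y0)) /= expr1 scaleN1r.
rewrite (linear_N (ractL _)) (linear_N (cL _)).
rewrite [in RHS](addrACA (ract _ _ _)) [RHS]addrACA (addrA (ract _ _ _)).
congr (_ + _); rewrite addrC; congr (_ + _); exact: addrC.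
Qed.

Lemma hat_cochain : is_cochain 2 (hat c).
Proof.
split.
- by case=> [|x [|x' [|x'' s]]] [|y [|y' [|y'' t]]] //=; rewrite addnS.
- case=> [|x [|x' [|x'' s]]] [|y [|y' [|y'' t]]] //=.
  exact: homogeneousZ.
- move=> [|x1 [|x2 [|z s1]]] [|x3 [|x4 s2]] [|y [|y' t]] k x x' /=;
    rewrite ?inEven_linear ?cL ?cR ?scaler0 ?addr0 //;
    by rewrite scalerDr !scalerA mulrC.
- by move=> [|x1 [|x2 [|x3 s]]] [|y1 [|y2 [|z t1]]] [|y3 [|y4 t2]] k y y' /=;
    rewrite ?inOdd_linear ?cL ?cR ?scaler0 ?addr0.
move=> [|x1 [|x2 [|x3 s]]] [|y1 [|y2 [|y3 t1]]] [|y4 [|y5 t2]] [|y6 t3] y y' /=;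
  rewrite ?oppr0 //.
by rewrite (c_comm _ _ _ _ (inOdd_homogeneous _) (inOdd_homogeneous _)) expr1 scaleN1r.
Qed.

(** The coefficients 1/4, 1/2 and 1/3 can be cancelled in characteristic 0, and [delta_supp]
    disposes of words of length other than three. *)
Lemma cocycle_hatE : cocycle mul act 2 (hat c) <-> extension_equations c.
Proof.
have inv_neq0 n : n.+1%:R^-1 != 0 :> K by rewrite invr_eq0 (pcharf0P K).1.
split=> [[_ h]|[h1 h2 h3 h4]].
  split.
  - move=> x1 x2 x3; have /eqP := h [:: x1; x2; x3] [::]; rewrite delta_hat30.
    rewrite scaler_eq0 mulf_eq0 (negPf (inv_neq0 1)) /= subr_eq0 eq_sym.
    by move/eqP.
  - move=> x1 x2 y; have /eqP := h [:: x1; x2] [:: y]; rewrite delta_hat21.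
    by rewrite subr_eq0 eq_sym => /eqP.
  - move=> x y1 y2; have /eqP := h [:: x] [:: y1; y2]; rewrite delta_hat12.
    by rewrite scaler_eq0 (negPf (inv_neq0 1)) /= subr_eq0 eq_sym => /eqP.
  - move=> y1 y2 y3; have /eqP := h [::] [:: y1; y2; y3]; rewrite delta_hat03.
    by rewrite scaler_eq0 (negPf (inv_neq0 2)) => /eqP.
split; first exact: hat_cochain.
move=> s t; have [|] := eqVneq (size s + size t)%N 3; last first.
  exact: delta_supp hat_cochain.
case: s => [|x1 [|x2 [|x3 [|x4 s]]]]; case: t => [|y1 [|y2 [|y3 [|y4 t]]]] //= _.
all: try by rewrite ?addnS.
- by rewrite delta_hat03 h4 scaler0.
- by rewrite delta_hat12 h3 subrr scaler0.
- by rewrite delta_hat21 h2 subrr.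
- by rewrite delta_hat30 h1 subrr scaler0.
Qed.

End Cocycle.

(** * Coboundaries and isomorphisms of extensions *)

Definition preserves_parity (L : tot a -> tot B) : Prop :=
  forall i u, homogeneous i u -> homogeneous i (L u).

(** Vanishes exactly when [L] is a derivation of [a] into the bimodule [B]. *)
Definition defect (L : tot a -> tot B) u v :=
  L (mul u v) - act u (L v) - ract act (L u) v.

Definition hat1 (L : tot a -> tot B) : cochain a B := fun s t =>
  match s, t with
  | [:: x], [::] => L (inEven x)
  | [::], [:: y] => L (inOdd y)
  | _, _ => 0
  end.

Lemma hat_sub c c' s t :
  hat (fun u v => c u v - c' u v) s t = hat c s t - hat c' s t.
Proof.
by case: s t => [|x [|x' [|x'' s]]] [|y [|y' [|y'' t]]] /=;
  rewrite ?scalerBr ?subr0.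
Qed.

(** [hat] does not record the (odd, even) values; graded commutativity recovers them from the (even,
    odd) ones. *)
Lemma hat_inj c c' : is_bilinear c -> graded_commutative c ->
  is_bilinear c' -> graded_commutative c' ->
  (forall s t, hat c s t = hat c' s t) -> forall u v, c u v = c' u v.
Proof.
move=> [cL cR] c_comm [c'L c'R] c'_comm eq_c u v.
have ee x x' : c (inEven x) (inEven x') = c' (inEven x) (inEven x').
  by apply: (scalerI two_inv_neq0); apply: (eq_c [:: x; x'] [::]).
have eo x y : c (inEven x) (inOdd y) = c' (inEven x) (inOdd y).
  exact: (eq_c [:: x] [:: y]).
have oo y y' : c (inOdd y) (inOdd y') = c' (inOdd y) (inOdd y').
  exact: (eq_c [::] [:: y; y']).
have oe y x : c (inOdd y) (inEven x) = c' (inOdd y) (inEven x).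
  rewrite (c_comm _ _ _ _ (inOdd_homogeneous y) (inEven_homogeneous x)) eo.
  by rewrite (c'_comm _ _ _ _ (inOdd_homogeneous y) (inEven_homogeneous x)).
rewrite (partD u) (partD v) /=.
rewrite !(linear_D (cL _)) !(linear_D (cR _)) !(linear_D (c'L _)) !(linear_D (c'R _)).
by rewrite ee eo oe oo.
Qed.

Section LinearDefect.
Variables (L : tot a -> tot B) (L_lin : linear L) (L_par : preserves_parity L).

Lemma defect_bilinear : is_bilinear (defect L).
Proof.
split=> [w'|w] k v v'; rewrite /defect ?(mulL, mulR) !L_lin ?(actL, actR)
  ?(ractL, ractR) !opprD -!scalerN !scalerDr;
  by rewrite (addrACA (k *: L _)) [LHS]addrACA.
Qed.

Lemma defect_parity : parity_preserving2 (defect L).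
Proof.
move=> i j u v hu hv; rewrite /defect.
rewrite (ract_homogeneous _ _ _ _ (L_par _ _ hu) hv) -!scaleN1r.
apply: homogeneousD; last first.
  by do 2!apply: homogeneousZ; rewrite addbC; apply: act_par; last exact: L_par.
apply: homogeneousD; first exact: L_par (la_parity Ha hu hv).
by apply: homogeneousZ; apply: act_par; last exact: L_par.
Qed.

Lemma defect_commutative : graded_commutative (defect L).
Proof.
move=> i j u v hu hv; rewrite /defect.
rewrite (ract_homogeneous _ _ _ _ (L_par _ _ hu) hv).
rewrite (ract_homogeneous _ _ _ _ (L_par _ _ hv) hu).
rewrite (la_commutative Ha hu hv) (linear_Z L_lin) !scalerBr scalerA andbC -expr2.
by rewrite sqrr_sign scale1r addrAC.
Qed.

Lemma hat1_cochain : is_cochain 1 (hat1 L).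
Proof.
split.
- by case=> [|x [|x' s]] [|y [|y' t]] //=; rewrite addnS.
- by case=> [|x [|x' s]] [|y [|y' t]] //=; apply: L_par.
- by move=> [|x1 [|x2 s1]] [|x3 s2] [|y t] k x x' /=;
    rewrite ?inEven_linear ?L_lin ?scaler0 ?addr0.
- by move=> [|x1 [|x2 s]] [|y1 [|y2 t1]] [|y3 t2] k y y' /=;
    rewrite ?inOdd_linear ?L_lin ?scaler0 ?addr0.
- by move=> [|x1 [|x2 s]] [|y1 [|y2 t1]] [|y3 t2] [|y4 t3] y y' /=; rewrite oppr0.
Qed.

Let L_e x : homogeneous false (L (inEven x)).
Proof. exact: L_par. Qed.
Let L_o y : homogeneous true (L (inOdd y)).
Proof. exact: L_par. Qed.

Lemma delta_hat1 s t : delta mul act (hat1 L) s t = hat (defect L) s t.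
Proof.
have [st2|st2] := eqVneq (size s + size t)%N 2; last first.
  rewrite (delta_supp _ _ _ _ hat1_cochain st2).
  have [hL hR] := defect_bilinear.
  rewrite (cochain_supp (hat_cochain _ defect_bilinear defect_parity
    defect_commutative)) //.
case: s t st2 => [|x1 [|x2 [|x3 s]]] [|y1 [|y2 [|y3 t]]] //= _.
all: try by rewrite ?addnS.
- rewrite /delta /= !big_ord_recl !big_ord0 /= !mAA_odd_odd.
  rewrite !(mBA_homogeneous (L_o _) (inOdd_homogeneous _)) /=.
  rewrite mul_oo.
  have -> : bump 0 0 = 1%N by [].
  (* In bidegree (0,1) [kappa] is 2 and cancels the averaging factor 1/2, so that the action terms
     match the coefficient of [L] on the product. *)
  rewrite [kappa K _ _]/= mul1n divff //
    !(exprD, expr0, expr1, sqrrN, expr1n, mulr1, mul1r, mulN1r,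
      opprK, scaleNr, scale1r, add0r, addr0) /defect.
  rewrite (ract_homogeneous _ _ _ _ (L_o y2) (inOdd_homogeneous y1)) /= expr1.
  by rewrite scaleN1r addrC addrA.
- rewrite /delta /= !big_ord_recl !big_ord0 /= !mAA_even_odd.
  rewrite !(mBA_homogeneous (L_e _) (inOdd_homogeneous _)) /=.
  rewrite !(mAB_homogeneous (inEven_homogeneous _) (L_o _)) /=.
  rewrite mul_eo.
  rewrite [kappa K _ _]/= invr1
    !(exprD, expr0, expr1, sqrrN, expr1n, mulr1, mul1r, mulN1r,
      opprK, scaleNr, scale1r, add0r, addr0).
  by rewrite [- _ + _]addrC.
- rewrite /delta /= !big_ord_recl !big_ord0 /= !mAA_even_even.
  rewrite !(mBA_homogeneous (L_e _) (inEven_homogeneous _)) /=.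
  rewrite !(mAB_homogeneous (inEven_homogeneous _) (L_e _)) /=.
  rewrite (linear_Z inEven_linear) mul_ee (linear_Z L_lin).
  rewrite !(exprD, expr0, expr1, sqrrN, expr1n, mulr1, mul1r, mulN1r,
      opprK, scaleNr, scale1r, add0r, addr0) -!scalerN -!scalerDr.
  by rewrite [- _ + _]addrC.
Qed.

End LinearDefect.

Lemma ext_mul_isoE L c1 c2 : linear L ->
  lie_antialgebra_iso (ext_mul mul act c1) (ext_mul mul act c2)
    (fun w => gpair (gfst w) (gsnd w + L (gfst w)))
  <-> preserves_parity L /\ forall u v, c2 u v - c1 u v = defect L u v.
Proof.
move=> L_lin.
(* This is multiplicativity in the [B]-component: the terms in [b] and [b'] agree on both sides and
   cancel. *)
have iso_gsnd u v b b' :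
    act u b' + ract act b v + c1 u v + L (mul u v)
      = act u (b' + L v) + ract act (b + L u) v + c2 u v
    <-> c2 u v - c1 u v = defect L u v.
  rewrite (linear_D (actR _)) (linear_D (ractL _)) /defect (addrACA (act u b')).
  rewrite -!(addrA (act u b' + _)) -[_ - _ - _]addrA -opprD; split=> [/addrI e|e].
    by apply/eqP; rewrite subr_eq addrAC eq_sym subr_eq addrC e addrC.
  rewrite -[c2 u v](subrK (c1 u v)) e; congr (_ + _).
  by rewrite [RHS]addrA [X in _ = X + _]addrC subrK addrC.
split=> [[f_lin f_par f_mul _]|[L_par e]].
  split=> [i u hu|u v].
    have /gsnd_homogeneous := f_par _ _ (inA_homogeneous _ _ hu).
    by rewrite gsnd_gpair !gfst_gpair gsnd_gpair add0r.
  apply/(iso_gsnd u v 0 0).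
  have /(congr1 (@gsnd K a B)) := f_mul (inA B u) (inA B v).
  by rewrite !(gsnd_ext_mul, gfst_ext_mul, gsnd_gpair, gfst_gpair).
split.
- by move=> k w w'; rewrite gfst_linear gsnd_linear L_lin addrACA -scalerDr gpair_linear.
- move=> i w hw; apply: gpair_homogeneous; first exact: gfst_homogeneous.
  by apply: homogeneousD; [exact: gsnd_homogeneous|apply/L_par/gfst_homogeneous].
- move=> w w'; apply: dsum_eq.
    by rewrite !(gfst_ext_mul, gfst_gpair).
  rewrite !(gsnd_ext_mul, gfst_ext_mul, gsnd_gpair, gfst_gpair).
  exact/iso_gsnd.
(* The map fixes [a]-parts, so it is inverted by replacing [L] with its negative. *)
- exists (fun w => gpair (gfst w) (gsnd w - L (gfst w))) => w;
    by apply: dsum_eq; rewrite ?(gfst_gpair, gsnd_gpair) ?addrK ?subrK.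
Qed.

(** * Degree-one cochains, degree-two coboundaries and their cosets *)

Lemma one_cochainP psi : is_cochain 1 psi <->
  exists L, [/\ linear L, preserves_parity L & psi = hat1 L].
Proof.
split=> [psi1|[L [L_lin L_par ->]]]; last exact: hat1_cochain.
have E_lin : linear (fun x => psi [:: x] [::]) := cochain_linear_even psi1 [::] [::] [::].
have O_lin : linear (fun y => psi [::] [:: y]) := cochain_linear_odd psi1 [::] [::] [::].
(* The components in bidegrees (1,0) and (0,1) are glued into one map; on a homogeneous element one
   summand vanishes by linearity. *)
exists (fun u => psi [:: u.1] [::] + psi [::] [:: u.2]); split.
- by move=> k u v; rewrite /= E_lin O_lin scalerDr addrACA.
- move=> i u /homogeneousP hu.
  case: i hu => ->; rewrite ?(linear_0 E_lin) ?(linear_0 O_lin) ?add0r ?addr0.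
    exact: cochain_parity psi1 [::] [:: u.2].
  exact: cochain_parity psi1 [:: u.1] [::].
apply/funext => s; apply/funext => t.
by case: s t => [|x [|x' s]] [|y [|y' t]] /=;
  rewrite ?(linear_0 E_lin) ?(linear_0 O_lin) ?add0r ?addr0 //;
  apply: (cochain_supp psi1); rewrite /= ?addnS.
Qed.

Lemma coboundary2P phi : coboundary mul act 2 phi <->
  exists L, [/\ linear L, preserves_parity L
               & forall s t, phi s t = hat (defect L) s t].
Proof.
split=> [[psi /one_cochainP[L [L_lin L_par ->]] e]|[L [L_lin L_par e]]].
  by exists L; split=> // s t; rewrite e delta_hat1.
by exists (hat1 L); [exact: hat1_cochain|move=> s t; rewrite delta_hat1].
Qed.

Lemma linear_sub (L M : tot a -> tot B) : linear L -> linear M ->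
  linear (fun u => L u - M u).
Proof.
by move=> L_lin M_lin k u v; rewrite L_lin M_lin opprD addrACA scalerBr.
Qed.

Lemma preserves_parity_sub L M : preserves_parity L -> preserves_parity M ->
  preserves_parity (fun u => L u - M u).
Proof.
move=> L_par M_par i u hu; rewrite -scaleN1r.
by apply: homogeneousD; [exact: L_par|apply/homogeneousZ/M_par].
Qed.

Lemma defect_sub L M u v :
  defect (fun z => L z - M z) u v = defect L u v - defect M u v.
Proof.
rewrite /defect (linear_B (actR _)) (linear_B (ractL _)).
by rewrite !opprD !opprK (addrACA (L _)) [LHS]addrACA.
Qed.

Lemma cohomology_class_subset c1 c2 L : linear L -> preserves_parity L ->
  (forall u v, c2 u v - c1 u v = defect L u v) ->
  (cohomology_class mul act 2 (hat c1)
    `<=` cohomology_class mul act 2 (hat c2))%classic.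
Proof.
move=> L_lin L_par e psi [psi_coc /coboundary2P[M [M_lin M_par eM]]].
(* [psi] differs from [hat c1] by the coboundary of [M], and [c2] from [c1] by that of [L], so [psi]
   differs from [hat c2] by that of [M - L]. *)
split=> //; apply/coboundary2P; exists (fun u => M u - L u); split.
- exact: linear_sub.
- exact: preserves_parity_sub.
move=> s t.
have -> : defect (fun u => M u - L u) = fun u v => defect M u v - defect L u v.
  by apply/funext => u; apply/funext => v; exact: defect_sub.
rewrite hat_sub -eM.
have -> : defect L = fun u v => c2 u v - c1 u v.
  by apply/funext => u; apply/funext => v; rewrite e.
by rewrite hat_sub opprB addrA subrK.
Qed.

Lemma bilinear_sub c1 c2 : is_bilinear c1 -> is_bilinear c2 ->
  is_bilinear (fun u v => c1 u v - c2 u v).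
Proof.
move=> [c1L c1R] [c2L c2R].
by split=> w; apply: linear_sub.
Qed.

Lemma graded_commutative_sub c1 c2 :
  graded_commutative c1 -> graded_commutative c2 ->
  graded_commutative (fun u v => c1 u v - c2 u v).
Proof.
move=> c1_comm c2_comm i j u v hu hv.
by rewrite (c1_comm _ _ _ _ hu hv) (c2_comm _ _ _ _ hu hv) scalerBr.
Qed.

Lemma cohomology_class_eqE c1 c2 :
  is_bilinear c1 -> graded_commutative c1 ->
  is_bilinear c2 -> graded_commutative c2 ->
  cocycle mul act 2 (hat c2) ->
  cohomology_class mul act 2 (hat c1) = cohomology_class mul act 2 (hat c2)
  <-> exists L, [/\ linear L, preserves_parity L
                   & forall u v, c2 u v - c1 u v = defect L u v].
Proof.
move=> c1_bil c1_comm c2_bil c2_comm c2_coc.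
pose O : tot a -> tot B := fun=> 0.
have O_lin : linear O by move=> k u v; rewrite scaler0 addr0.
have O_par : preserves_parity O by move=> i u _; apply: homogeneous0.
have O0 u v : defect O u v = 0.
  by rewrite /defect (linear_0 (actR _)) (linear_0 (ractL _)) !subr0.
split=> [e|[L [L_lin L_par e]]]; last first.
  apply/seteqP; split; first exact: (cohomology_class_subset _ _ L).
  (* The reverse inclusion uses the negative of [L], written as a difference so that the subtraction
     lemmas apply. *)
  apply: (cohomology_class_subset _ _ (fun u => O u - L u)).
  - exact: linear_sub.
  - exact: preserves_parity_sub.
  by move=> u v; rewrite defect_sub O0 sub0r -e opprB.
(* A cocycle lies in its own class, with the zero map as witness; equality of the classes then puts
   [hat c2] in the class of [hat c1]. *)
have [_ /coboundary2P[L [L_lin L_par eL]]] :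
    cohomology_class mul act 2 (hat c1) (hat c2).
  rewrite e; split=> //; apply/coboundary2P; exists O; split=> // s t.
  have -> : defect O = fun u v => c2 u v - c2 u v.
    by apply/funext => u; apply/funext => v; rewrite O0 subrr.
  by rewrite hat_sub.
exists L; split=> //; apply: hat_inj.
- exact: bilinear_sub.
- exact: graded_commutative_sub.
- exact: defect_bilinear.
- exact: defect_commutative.
by move=> s t; rewrite hat_sub.
Qed.

End Extensions.

Theorem proposition6p2 (K : fieldType) (charK : [pchar K] =i pred0)
    (a : gspace K) (mul : tot a -> tot a -> tot a) (Ha : lie_antialgebra mul)
    (B : gspace K) (act : tot a -> tot B -> tot B) (HB : is_module mul act) :
  (forall c : tot a -> tot a -> tot B,
     is_bilinear c -> parity_preserving2 c -> graded_commutative c ->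
     (lie_antialgebra (ext_mul mul act c) <-> cocycle mul act 2 (hat c)))
  /\
  (forall c1 c2 : tot a -> tot a -> tot B,
     is_bilinear c1 -> parity_preserving2 c1 -> graded_commutative c1 ->
     is_bilinear c2 -> parity_preserving2 c2 -> graded_commutative c2 ->
     cocycle mul act 2 (hat c1) -> cocycle mul act 2 (hat c2) ->
     ((exists2 L : tot a -> tot B, linear L &
         lie_antialgebra_iso (ext_mul mul act c1) (ext_mul mul act c2)
           (fun w => gpair (gfst w) (gsnd w + L (gfst w))))
      <-> cohomology_class mul act 2 (hat c1)
          = cohomology_class mul act 2 (hat c2))).
Proof.
split=> [c c_bil c_par c_comm|c1 c2 c1_bil _ c1_comm c2_bil _ c2_comm _ c2_coc].
  by rewrite cocycle_hatE // ext_lie_antialgebraE.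
rewrite cohomology_class_eqE //.
split=> [[L L_lin f_iso]|[L [L_lin L_par e]]]; exists L => //.
  by move/ext_mul_isoE: f_iso => [].
by apply/ext_mul_isoE.
Qed.
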